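(* Let $X$ be a loop, $\sim$ an equivalence relation on $\{1,\dots,k\}$ with $\ell$ equivalence classes and $\varphi_i\in\mathrm{Aut}(X)$ for every $1\le i\le k$. Then $$S_X^\sim(\varphi_1,\dots,\varphi_k)=\{(x_1,\dots,x_k)\in X^k:\varphi_i(x_i)=\varphi_j(x_j)\text{ whenever }i\sim j\}$$ is a subdirect product of $X^k$ and it is isomorphic to $X^\ell$.
   Context: A loop is an algebra $(X,\cdot,\backslash,/,e)$ satisfying $x(x\backslash y)=y=x\backslash(xy)$, $(x/y)y=x=(xy)/y$ and $ex=xe=x$. A subloop $A$ of $X^k$ is a subdirect product of $X^k$ if for every $1\le i\le k$ the $i$th coordinate projection maps $A$ onto $X$. *)

(* Defs.v *)
From HB Require Import structures.
From mathcomp Require Import all_boot.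
From mathcomp Require Import boolp classical_sets.

Set Implicit Arguments.
Unset Strict Implicit.
Unset Printing Implicit Defensive.

(* [ldiv x y] is x \ y and [rdiv x y] is x / y. *)
HB.mixin Record isLoop (X : Type) := {
  mul : X -> X -> X;
  ldiv : X -> X -> X;
  rdiv : X -> X -> X;
  loop_unit : X;
  mul_ldiv : forall x y, mul x (ldiv x y) = y;
  ldiv_mul : forall x y, ldiv x (mul x y) = y;
  rdiv_mul : forall x y, mul (rdiv x y) y = x;
  mul_rdiv : forall x y, rdiv (mul x y) y = x;
  unit_mul : forall x, mul loop_unit x = x;
  mul_unit : forall x, mul x loop_unit = x
}.

#[short(type="loopType")]
HB.structure Definition Loop := { X of isLoop X }.

Definition loop_hom (X Y : loopType) (f : X -> Y) : Prop :=
  [/\ forall x y, f (mul x y) = mul (f x) (f y),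
      forall x y, f (ldiv x y) = ldiv (f x) (f y),
      forall x y, f (rdiv x y) = rdiv (f x) (f y)
    & f loop_unit = loop_unit].

Definition loop_iso (X Y : loopType) (f : X -> Y) : Prop :=
  loop_hom f /\ bijective f.

Definition loop_aut (X : loopType) (f : X -> X) : Prop := loop_iso f.

Definition loop_isomorphic (X Y : loopType) : Prop :=
  exists f : X -> Y, loop_iso f.

Definition pow_mul (I : finType) (X : loopType) (x y : {ffun I -> X}) :=
  [ffun i => mul (x i) (y i)].
Definition pow_ldiv (I : finType) (X : loopType) (x y : {ffun I -> X}) :=
  [ffun i => ldiv (x i) (y i)].
Definition pow_rdiv (I : finType) (X : loopType) (x y : {ffun I -> X}) :=
  [ffun i => rdiv (x i) (y i)].
Definition pow_unit (I : finType) (X : loopType) : {ffun I -> X} :=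
  [ffun=> loop_unit].

Fact pow_mul_ldiv (I : finType) (X : loopType) (x y : {ffun I -> X}) :
  pow_mul x (pow_ldiv x y) = y.
Proof. by apply/ffunP=> i; rewrite !ffunE mul_ldiv. Qed.
Fact pow_ldiv_mul (I : finType) (X : loopType) (x y : {ffun I -> X}) :
  pow_ldiv x (pow_mul x y) = y.
Proof. by apply/ffunP=> i; rewrite !ffunE ldiv_mul. Qed.
Fact pow_rdiv_mul (I : finType) (X : loopType) (x y : {ffun I -> X}) :
  pow_mul (pow_rdiv x y) y = x.
Proof. by apply/ffunP=> i; rewrite !ffunE rdiv_mul. Qed.
Fact pow_mul_rdiv (I : finType) (X : loopType) (x y : {ffun I -> X}) :
  pow_rdiv (pow_mul x y) y = x.
Proof. by apply/ffunP=> i; rewrite !ffunE mul_rdiv. Qed.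
Fact pow_unit_mul (I : finType) (X : loopType) (x : {ffun I -> X}) :
  pow_mul (pow_unit I X) x = x.
Proof. by apply/ffunP=> i; rewrite !ffunE unit_mul. Qed.
Fact pow_mul_unit (I : finType) (X : loopType) (x : {ffun I -> X}) :
  pow_mul x (pow_unit I X) = x.
Proof. by apply/ffunP=> i; rewrite !ffunE mul_unit. Qed.

(* With I := 'I_k this is the direct power X^k, coordinates numbered from 0. *)
HB.instance Definition _ (I : finType) (X : loopType) :=
  isLoop.Build {ffun I -> X}
    (@pow_mul_ldiv I X) (@pow_ldiv_mul I X) (@pow_rdiv_mul I X)
    (@pow_mul_rdiv I X) (@pow_unit_mul I X) (@pow_mul_unit I X).

Record subloop (X : loopType) (A : set X) : Prop := Subloop {
  subloop_mul : forall x y, A x -> A y -> A (mul x y);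
  subloop_ldiv : forall x y, A x -> A y -> A (ldiv x y);
  subloop_rdiv : forall x y, A x -> A y -> A (rdiv x y);
  subloop_unit : A loop_unit
}.

Definition subloop_type (X : loopType) (A : set X) (hA : subloop A) : Type :=
  {x : X | A x}.

Definition sub_mul (X : loopType) (A : set X) (hA : subloop A)
    (x y : subloop_type hA) : subloop_type hA :=
  exist _ _ (subloop_mul hA (proj2_sig x) (proj2_sig y)).
Definition sub_ldiv (X : loopType) (A : set X) (hA : subloop A)
    (x y : subloop_type hA) : subloop_type hA :=
  exist _ _ (subloop_ldiv hA (proj2_sig x) (proj2_sig y)).
Definition sub_rdiv (X : loopType) (A : set X) (hA : subloop A)
    (x y : subloop_type hA) : subloop_type hA :=
  exist _ _ (subloop_rdiv hA (proj2_sig x) (proj2_sig y)).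
Definition sub_unit (X : loopType) (A : set X) (hA : subloop A) :
    subloop_type hA :=
  exist _ _ (subloop_unit hA).

Lemma subloop_inj (X : loopType) (A : set X) (hA : subloop A)
    (x y : subloop_type hA) :
  proj1_sig x = proj1_sig y -> x = y.
Proof. by case: x y => [x hx] [y hy] /= exy; apply: eq_exist. Qed.

Fact sub_mul_ldiv (X : loopType) (A : set X) (hA : subloop A)
    (x y : subloop_type hA) : sub_mul x (sub_ldiv x y) = y.
Proof. by apply: subloop_inj; rewrite /= mul_ldiv. Qed.
Fact sub_ldiv_mul (X : loopType) (A : set X) (hA : subloop A)
    (x y : subloop_type hA) : sub_ldiv x (sub_mul x y) = y.
Proof. by apply: subloop_inj; rewrite /= ldiv_mul. Qed.
Fact sub_rdiv_mul (X : loopType) (A : set X) (hA : subloop A)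
    (x y : subloop_type hA) : sub_mul (sub_rdiv x y) y = x.
Proof. by apply: subloop_inj; rewrite /= rdiv_mul. Qed.
Fact sub_mul_rdiv (X : loopType) (A : set X) (hA : subloop A)
    (x y : subloop_type hA) : sub_rdiv (sub_mul x y) y = x.
Proof. by apply: subloop_inj; rewrite /= mul_rdiv. Qed.
Fact sub_unit_mul (X : loopType) (A : set X) (hA : subloop A)
    (x : subloop_type hA) : sub_mul (sub_unit hA) x = x.
Proof. by apply: subloop_inj; rewrite /= unit_mul. Qed.
Fact sub_mul_unit (X : loopType) (A : set X) (hA : subloop A)
    (x : subloop_type hA) : sub_mul x (sub_unit hA) = x.
Proof. by apply: subloop_inj; rewrite /= mul_unit. Qed.

HB.instance Definition _ (X : loopType) (A : set X) (hA : subloop A) :=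
  isLoop.Build (subloop_type hA)
    (@sub_mul_ldiv X A hA) (@sub_ldiv_mul X A hA) (@sub_rdiv_mul X A hA)
    (@sub_mul_rdiv X A hA) (@sub_unit_mul X A hA) (@sub_mul_unit X A hA).

Definition subdirect (X : loopType) (k : nat) (A : set {ffun 'I_k -> X}) :
    Prop :=
  subloop A /\
  forall i : 'I_k, ((fun x : {ffun 'I_k -> X} => x i) @` A = setT)%classic.

Definition S_loop (X : loopType) (k : nat) (sim : rel 'I_k)
    (phi : 'I_k -> X -> X) : set {ffun 'I_k -> X} :=
  [set x : {ffun 'I_k -> X} |
    forall i j, sim i j -> phi i (x i) = phi j (x j)]%classic.

(* Main.v *)
Require Import Defs.
From HB Require Import structures.
From mathcomp Require Import all_boot.
From mathcomp Require Import boolp classical_sets.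

(** A tuple in [S_loop sim phi] is determined by one value per class, namely
    the common value of [phi i (x i)] over the indices [i] of that class, and
    these values are arbitrary because each [phi i] is bijective. *)

(** Numbering the blocks of the partition gives [c]; blocks are nonempty, so choosing an element in
    each gives the system of representatives [r]. *)
Lemma equivalence_partition_index (T : finType) (R : rel T) (l : nat) :
  equivalence_rel R -> #|equivalence_partition R [set: T]%SET| = l ->
  exists (c : T -> 'I_l) (r : 'I_l -> T),
    cancel r c /\ forall i j, R i j = (c i == c j).
Proof.
set P := equivalence_partition R _ => R_equiv <-{l}.
have R_equivT : {in [set: T]%SET & &, equivalence_rel R}.
  by move=> x y z _ _ _; apply: R_equiv.
have partP : finset.partition P [set: T]%SET := equivalence_partitionP R_equivT.
have /and3P[/eqP coverP trivP set0P] := partP.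
have blockP i : finset.pblock P i \in P by rewrite pblock_mem // coverP inE.
(* The rank of the block of [i] among all blocks; [blockP i] supplies the element of [P] that
   [enum_rank_in] needs as a default. *)
pose c i := enum_rank_in (blockP i) (finset.pblock P i).
have cK i : enum_val (c i) = finset.pblock P i by rewrite enum_rankK_in.
have block_nonempty (m : 'I_#|P|) : exists i, i \in enum_val m.
  apply/set0Pn; apply: contraNneq set0P => <-; exact: enum_valP.
have [r rP] := choice block_nonempty.
exists c, r; split=> [m | i j].
  apply: enum_val_inj; rewrite cK.
  by apply: (def_pblock trivP) (rP m); apply: enum_valP.
(* Equal ranks mean equal blocks, that is, [j] lies in the block of [i]. *)
rewrite -(inj_eq enum_val_inj) !cK eq_pblock ?coverP ?inE //.
by rewrite pblock_equivalence_partition ?inE.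
Qed.

(** An intersection of equalizers of pairs of homomorphisms [x] ↦ [phi i (x i)] and [x] ↦
    [phi j (x j)]. *)
Lemma subloop_S_loop (X : loopType) (k : nat) (sim : rel 'I_k)
    (phi : 'I_k -> X -> X) :
  (forall i, loop_hom (phi i)) -> subloop (S_loop sim phi).
Proof.
move=> phi_hom; split=> [x y Sx Sy | x y Sx Sy | x y Sx Sy |] i j ij;
  have [iM iL iR i1] := phi_hom i; have [jM jL jR j1] := phi_hom j;
  rewrite !ffunE.
- by rewrite iM jM (Sx i j ij) (Sy i j ij).
- by rewrite iL jL (Sx i j ij) (Sy i j ij).
- by rewrite iR jR (Sx i j ij) (Sy i j ij).
- by rewrite i1 j1.
Qed.

Theorem lemma3p8 (X : loopType) (k l : nat) (sim : rel 'I_k)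
    (sim_equiv : equivalence_rel sim)
    (sim_classes : #|equivalence_partition sim [set: 'I_k]%SET| = l)
    (phi : 'I_k -> X -> X) (phi_aut : forall i, loop_aut (phi i)) :
  subdirect (S_loop sim phi) /\
  exists hS : subloop (S_loop sim phi),
    loop_isomorphic (subloop_type hS) {ffun 'I_l -> X}.
Proof.
have phi_hom i : loop_hom (phi i) := proj1 (phi_aut i).
have phi_inv i : exists g, cancel (phi i) g /\ cancel g (phi i).
  by have [_ [g phiK gK]] := phi_aut i; exists g.
have [psi psiP] := choice phi_inv.
have phiK i : cancel (phi i) (psi i) := proj1 (psiP i).
have psiK i : cancel (psi i) (phi i) := proj2 (psiP i).
have [c [r [rK simE]]] := equivalence_partition_index _ _ _ sim_equiv sim_classes.
(* The tuple whose common value on class [m] is [y m]; it will be the inverse isomorphism. *)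
pose lift_classes (y : {ffun 'I_l -> X}) : {ffun 'I_k -> X} :=
  [ffun i => psi i (y (c i))].
have S_lift y : S_loop sim phi (lift_classes y).
  by move=> i j; rewrite simE !ffunE !psiK => /eqP->.
have hS := subloop_S_loop _ _ sim _ phi_hom.
split.
  split=> // i; apply/seteqP; split=> // a _ /=.
  (* Giving every class the value [phi i a] makes coordinate [i] equal to [psi i (phi i a) = a]. *)
  exists (lift_classes [ffun=> phi i a]) => //.
  by rewrite !ffunE phiK.
pose values (x : {ffun 'I_k -> X}) : {ffun 'I_l -> X} :=
  [ffun m => phi (r m) (x (r m))].
have valuesK x : S_loop sim phi x -> lift_classes (values x) = x.
  move=> Sx; apply/ffunP=> i; rewrite !ffunE.
  (* The index [i] and its representative [r (c i)] are equivalent, so the value read at the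
     representative is [phi i (x i)]. *)
  by rewrite (Sx (r (c i)) i) ?phiK // simE rK.
exists hS, (fun x : subloop_type hS => values (proj1_sig x)); split.
  (* Coordinate [m] of [values] is a projection followed by the homomorphism [phi (r m)]. *)
  split=> [x y | x y | x y |]; apply/ffunP=> m;
    by have [hM hL hR h1] := phi_hom (r m); rewrite !ffunE ?hM ?hL ?hR ?h1.
exists (fun y => exist _ (lift_classes y) (S_lift y)) => [x | y].
  by apply: (@subloop_inj _ _ hS); apply: valuesK (proj2_sig x).
by apply/ffunP=> m; rewrite !ffunE psiK rK.
Qed.
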